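(* Let $k$ be an algebraically closed field of characteristic $2$, let $n\geq 1$ be an integer, and let $F=k(\!(x_1)\!)\cdots(\!(x_n)\!)$ be the field of iterated formal Laurent series in $n$ variables over $k$. Then $u(F)=m(F)=2^n$.
   Context: Let $F$ be a field of characteristic $2$. A quadratic form $q:V\to F$ on a finite-dimensional $F$-vector space has the polar form $B_q(v,w)=q(v+w)-q(v)-q(w)$; $q$ is nonsingular if $B_q$ is nondegenerate. It is anisotropic if $q(v)\neq 0$ for all $v\neq 0$, and universal if it represents every element of $F^\times$. The $u$-invariant $u(F)$ is the maximal dimension of an anisotropic nonsingular quadratic form over $F$. The $m$-invariant $m(F)$ is the minimal dimension of a nonsingular anisotropic universal quadratic form over $F$, with $m(F)=\infty$ if no such form exists. *)

(* Defs.v *)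
From HB Require Import structures.
From mathcomp Require Import all_boot all_order all_algebra.
From mathcomp Require Import zify.
From mathcomp Require Import boolp classical_sets functions cardinality fsbigop.

Set Implicit Arguments.
Unset Strict Implicit.
Unset Printing Implicit Defensive.

Import Order.TTheory GRing.Theory Num.Theory.
Local Open Scope ring_scope.

(* [laurent K] is K((x)): the series \sum_i f_i x^i, i ranging over the
   integers, with f_i = 0 for all sufficiently negative i. *)
Record laurent (K : fieldType) := Laurent {
  lcoef :> int -> K;
  lcoef_bounded : exists N : int, forall i, i < N -> lcoef i = 0
}.

HB.instance Definition _ (K : fieldType) := gen_eqMixin (laurent K).
HB.instance Definition _ (K : fieldType) := gen_choiceMixin (laurent K).

Section LaurentField.
Variable K : fieldType.
Implicit Types (f g h : laurent K) (a b : int) (F G H : nat -> K).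

Lemma laurentP f g : (f =1 g) -> f = g.
Proof.
case: f g => [f Hf] [g Hg] /= /funext fg.
by subst g; congr Laurent; exact: Prop_irrelevance.
Qed.

Fact ladd_bounded f g :
  exists N : int, forall i, i < N -> f i + g i = 0.
Proof.
case: (lcoef_bounded f) => a fa; case: (lcoef_bounded g) => b gb.
by exists (Num.min a b) => i; rewrite lt_min => /andP[/fa -> /gb ->]; rewrite addr0.
Qed.
Definition ladd f g := Laurent (ladd_bounded f g).

Fact lopp_bounded f : exists N : int, forall i, i < N -> - f i = 0.
Proof.
by case: (lcoef_bounded f) => a fa; exists a => i /fa ->; rewrite oppr0.
Qed.
Definition lopp f := Laurent (lopp_bounded f).

Fact lzero_bounded : exists N : int, forall i, i < N -> (0 : K) = 0.
Proof. by exists 0. Qed.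
Definition lzero := Laurent lzero_bounded.

Fact lone_bounded :
  exists N : int, forall i, i < N -> (i == 0)%:R = 0 :> K.
Proof. by exists 0 => i; rewrite lt_neqAle => /andP[/negbTE ->]. Qed.
Definition lone := Laurent lone_bounded.

Fact laddA : associative ladd.
Proof. by move=> f g h; apply: laurentP => i /=; rewrite addrA. Qed.
Fact laddC : commutative ladd.
Proof. by move=> f g; apply: laurentP => i /=; rewrite addrC. Qed.
Fact ladd0 : left_id lzero ladd.
Proof. by move=> f; apply: laurentP => i /=; rewrite add0r. Qed.
Fact laddN : left_inverse lzero lopp ladd.
Proof. by move=> f; apply: laurentP => i /=; rewrite addNr. Qed.

HB.instance Definition _ :=
  GRing.isZmodule.Build (laurent K) laddA laddC ladd0 laddN.

(* The Cauchy product: the summand has finite support, so the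
   finitely-supported sum over all integers is the expected one. *)
Definition lmul_coef f g (n : int) : K :=
  \sum_(i \in [set: int]) (f i * g (n - i)).

(* [lrep f a F] : f = \sum_(j : nat) F_j x^(a + j) *)
Definition lrep f a F :=
  (forall i, i < a -> f i = 0) /\ (forall j : nat, f (a + j%:Z) = F j).

Lemma lrep_bound f a : (forall i, i < a -> f i = 0) ->
  lrep f a (fun j => f (a + j%:Z)).
Proof. by []. Qed.

Lemma lrep_eq f g a F G : lrep f a F -> lrep g a G -> F =1 G -> f = g.
Proof.
move=> [f0 fF] [g0 gG] FG; apply: laurentP => i.
have [/[dup] /f0 -> /g0 -> //|ai] := ltP i a.
have -> : i = a + (`|i - a|%N)%:Z by lia.
by rewrite fF gG FG.
Qed.

Definition conv F G k := \sum_(j < k.+1) F j * G (k - j)%N.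

Lemma lmul_coef_lt f g a b F G n : lrep f a F -> lrep g b G ->
  n < a + b -> lmul_coef f g n = 0.
Proof.
move=> [f0 _] [g0 _] nab; rewrite /lmul_coef; apply: fsbig1 => i _.
have [/f0 ->|ai] := ltP i a; first by rewrite mul0r.
by rewrite g0 ?mulr0 //; lia.
Qed.

Lemma lmul_coef_conv f g a b F G k : lrep f a F -> lrep g b G ->
  lmul_coef f g (a + b + k%:Z) = conv F G k.
Proof.
move=> [f0 fF] [g0 gG]; rewrite /lmul_coef /conv.
rewrite (@fsbigE _ _ _ _ _ [seq a + j%:Z | j <- iota 0 k.+1]) //.
- rewrite big_map -[iota 0 k.+1]/(index_iota 0 k.+1).
  under eq_bigl do rewrite in_setT.
  rewrite big_mkord; apply: eq_bigr => j _.
  rewrite fF; congr (_ * _); rewrite -gG; congr (lcoef g _).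
  by have := ltn_ord j; lia.
- by rewrite map_inj_uniq ?iota_uniq // => i j; lia.
move=> i _; apply: contraNeq; rewrite mulf_eq0 negb_or => /andP[fi gi].
have ai : a <= i by rewrite leNgt; apply: contra fi => /f0 ->.
have ib : b <= a + b + k%:Z - i by rewrite leNgt; apply: contra gi => /g0 ->.
apply/mapP; exists `|i - a|%N; last by lia.
by rewrite mem_iota; lia.
Qed.

Fact lmul_bounded f g :
  exists N : int, forall n, n < N -> lmul_coef f g n = 0.
Proof.
case: (lcoef_bounded f) => a /lrep_bound fa.
case: (lcoef_bounded g) => b /lrep_bound gb.
by exists (a + b) => n; exact: lmul_coef_lt fa gb.
Qed.
Definition lmul f g := Laurent (lmul_bounded f g).

Lemma lrep_mul f g a b F G : lrep f a F -> lrep g b G ->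
  lrep (lmul f g) (a + b) (conv F G).
Proof.
move=> fF gG; split=> [i|j] /=; first exact: lmul_coef_lt fF gG.
exact: lmul_coef_conv.
Qed.

Lemma lrep_add f g a F G : lrep f a F -> lrep g a G ->
  lrep (f + g) a (fun j => F j + G j).
Proof.
move=> [f0 fF] [g0 gG]; split=> [i ia|j].
  by rewrite -[LHS]/(f i + g i) f0 ?g0 ?addr0.
by rewrite -[LHS]/(f _ + g _) fF gG.
Qed.

Lemma lrep1 : lrep lone 0 (fun j => (j == 0%N)%:R).
Proof. by split=> [i|j] /=; [case: eqP => //; lia|rewrite add0r]. Qed.

Definition trunc F m : {poly K} := \poly_(i < m) F i.

Lemma coef_trunc_mul F G m k : (k < m)%N ->
  (trunc F m * trunc G m)`_k = conv F G k.
Proof.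
move=> km; rewrite coefM; apply: eq_bigr => j _; rewrite !coef_poly.
have jk := ltn_ord j.
by rewrite !ifT //; lia.
Qed.

Lemma convC F G : conv F G =1 conv G F.
Proof.
by move=> k; rewrite -!(@coef_trunc_mul _ _ k.+1) // mulrC.
Qed.

Lemma convA F G H : conv F (conv G H) =1 conv (conv F G) H.
Proof.
move=> k; have tr F1 G1 j : (j <= k)%N ->
    conv F1 G1 j = (trunc F1 k.+1 * trunc G1 k.+1)`_j.
  by move=> jk; rewrite coef_trunc_mul.
transitivity ((trunc F k.+1 * (trunc G k.+1 * trunc H k.+1))`_k).
  rewrite coefM; apply: eq_bigr => j _; rewrite tr ?leq_subr //.
  by rewrite coef_poly ltn_ord.
rewrite mulrA coefM; apply: eq_bigr => j _.
rewrite tr -1?ltnS ?ltn_ord // coef_poly ifT //; lia.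
Qed.

Lemma conv1 F : conv (fun j => (j == 0%N)%:R) F =1 F.
Proof.
move=> k; rewrite /conv big_ord_recl /= mul1r subn0 big1 ?addr0 // => i _.
by rewrite mul0r.
Qed.

Fact lmulA : associative lmul.
Proof.
move=> f g h; case: (lcoef_bounded f) => a /lrep_bound fa.
case: (lcoef_bounded g) => b /lrep_bound gb.
case: (lcoef_bounded h) => c /lrep_bound hc.
have L := lrep_mul fa (lrep_mul gb hc); rewrite addrA in L.
exact: lrep_eq L (lrep_mul (lrep_mul fa gb) hc) (convA _ _ _).
Qed.

Fact lmulC : commutative lmul.
Proof.
move=> f g; case: (lcoef_bounded f) => a /lrep_bound fa.
case: (lcoef_bounded g) => b /lrep_bound gb.
have L := lrep_mul fa gb; rewrite addrC in L.
exact: lrep_eq L (lrep_mul gb fa) (convC _ _).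
Qed.

Fact lmul1 : left_id lone lmul.
Proof.
move=> f; case: (lcoef_bounded f) => a /lrep_bound fa.
have L := lrep_mul lrep1 fa; rewrite add0r in L.
exact: lrep_eq L fa (conv1 _).
Qed.

Fact lmulDl : left_distributive lmul +%R.
Proof.
move=> f g h; case: (lcoef_bounded f) => a1 fa1.
case: (lcoef_bounded g) => a2 ga2.
case: (lcoef_bounded h) => c /lrep_bound hc.
set a := Num.min a1 a2.
have /lrep_bound fa : forall i, i < a -> f i = 0.
  by move=> i; rewrite lt_min => /andP[/fa1].
have /lrep_bound ga : forall i, i < a -> g i = 0.
  by move=> i; rewrite lt_min => /andP[_ /ga2].
apply: lrep_eq (lrep_mul (lrep_add fa ga) hc)
  (lrep_add (lrep_mul fa hc) (lrep_mul ga hc)) _.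
move=> k; rewrite /conv -big_split; apply: eq_bigr => j _ /=.
by rewrite mulrDl.
Qed.

Fact lone_neq0 : lone != 0 :> laurent K.
Proof.
apply/eqP => /(congr1 (fun f : laurent K => f 0)) /=; apply/eqP.
exact: oner_neq0.
Qed.

HB.instance Definition _ := GRing.Zmodule_isComNzRing.Build (laurent K)
  lmulA lmulC lmul1 lmulDl lone_neq0.

Fact lshift_bounded a F : exists N : int, forall i, i < N ->
  (if i < a then 0 else F `|i - a|%N) = 0.
Proof. by exists a => i ->. Qed.
Definition lshift a F := Laurent (lshift_bounded a F).

Lemma lrep_shift a F : lrep (lshift a F) a F.
Proof.
split=> [i /= -> //|j /=]; rewrite ifF; last by lia.
by congr F; lia.
Qed.

Fixpoint conv_inv_seq F n : seq K :=
  if n is m.+1 then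
    let s := conv_inv_seq F m in
    rcons s ((F 0%N)^-1 * ((m == 0%N)%:R - \sum_(j < m) s`_j * F (m - j)%N))
  else [::].

Lemma conv_inverse F : F 0%N != 0 ->
  exists G, conv G F =1 (fun j => (j == 0%N)%:R).
Proof.
move=> F0; pose s := conv_inv_seq F.
have size_s n : size (s n) = n by elim: n => //= n IH; rewrite size_rcons IH.
have s_stable m n j : (j < m)%N -> (m <= n)%N -> (s n)`_j = (s m)`_j.
  move=> jm; elim: n => [|n IH]; first by rewrite leqn0 => /eqP ->.
  rewrite leq_eqVlt => /orP[/eqP -> //|]; rewrite ltnS => mn.
  by rewrite /= nth_rcons size_s (leq_trans jm mn) IH.
exists (fun j => (s j.+1)`_j) => k; rewrite /conv big_ord_recr /= subnn.
rewrite nth_rcons size_s ltnn eqxx mulrAC mulVf // mul1r.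
rewrite addrC -[RHS](subrK (\sum_(j < k) (s k)`_j * F (k - j)%N)).
congr (_ + _); apply: eq_bigr => j _; congr (_ * _).
by rewrite (@s_stable j.+1).
Qed.

Lemma laurent_order f : f != 0 ->
  exists a, (forall i, i < a -> f i = 0) /\ f a != 0.
Proof.
move=> fn0; case: (lcoef_bounded f) => N fN.
have ex : exists j : nat, f (N + j%:Z) != 0.
  apply: contrapT => no; case/eqP: fn0; apply: laurentP => i /=.
  have [/fN //|Ni] := ltP i N.
  apply: contrapT => /eqP fi; apply: no; exists `|i - N|%N.
  by have -> : N + (`|i - N|%N)%:Z = i by lia.
have [m fm mmin] := ex_minnP ex; exists (N + m%:Z); split=> // i im.
have [/fN //|Ni] := ltP i N; apply: contrapT => /eqP fi.
have := mmin `|i - N|%N; have -> : N + (`|i - N|%N)%:Z = i by lia.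
by move=> /(_ fi); lia.
Qed.

Lemma laurent_inverse f : f != 0 -> exists g, g * f = 1.
Proof.
move=> /laurent_order[a [/lrep_bound fa fa0]].
have [|G GF] := @conv_inverse (fun j => f (a + j%:Z)).
  by rewrite addr0.
exists (lshift (- a) G).
have L := lrep_mul (lrep_shift (- a) G) fa; rewrite addNr in L.
exact: lrep_eq L lrep1 GF.
Qed.

Definition linv f : laurent K := xget 0 [set g | g * f = 1]%classic.

Fact lmulVf f : f != 0 -> linv f * f = 1.
Proof.
by move=> /laurent_inverse ex; rewrite /linv; case: xgetP => [g _ //|];
  case: ex => g gf /(_ g).
Qed.

Fact linv0 : linv 0 = 0.
Proof.
rewrite /linv; case: xgetP => [g -> /= /eqP|//].
by rewrite mulr0 eq_sym oner_eq0.
Qed.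

HB.instance Definition _ :=
  GRing.ComNzRing_isField.Build (laurent K) lmulVf linv0.

End LaurentField.

(* [iter_laurent k n] is k((x_1))...((x_n)). *)
Fixpoint iter_laurent (k : fieldType) (n : nat) : fieldType :=
  if n is m.+1 then laurent (iter_laurent k m) else k.

Section QuadraticForms.
Variables (F : fieldType) (V : vectType F).
Implicit Type q : V -> F.

Definition polar_form q (v w : V) : F := q (v + w) - q v - q w.

Definition quadratic_form q : Prop :=
  (forall (a : F) (v : V), q (a *: v) = a ^+ 2 * q v) /\
  bilinear_for *%R *%R (polar_form q).

Definition nonsingular q : Prop :=
  forall v : V, (forall w : V, polar_form q v w = 0) -> v = 0.

Definition anisotropic q : Prop := forall v : V, v != 0 -> q v != 0.

Definition universal q : Prop :=
  forall a : F, a != 0 -> exists v : V, q v = a.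

End QuadraticForms.

Definition dim_anisotropic (F : fieldType) (d : nat) : Prop :=
  exists (V : vectType F) (q : V -> F),
    [/\ \dim {:V} = d, quadratic_form q, nonsingular q & anisotropic q].

Definition dim_anisotropic_universal (F : fieldType) (d : nat) : Prop :=
  exists (V : vectType F) (q : V -> F),
    [/\ \dim {:V} = d, quadratic_form q, nonsingular q, anisotropic q
      & universal q].

Definition is_max_nat (P : nat -> Prop) (d : nat) : Prop :=
  P d /\ forall e, P e -> (e <= d)%N.

Definition is_min_nat (P : nat -> Prop) (d : nat) : Prop :=
  P d /\ forall e, P e -> (d <= e)%N.

(* Both invariants take values in the natural numbers extended by infinity,
   [None] standing for infinity. *)
Definition the_nat_or_infty (P : nat -> Prop) : option nat :=
  if pselect (exists d, P d) is left ex then Some (sval (cid ex)) else None.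

(* The form on the zero space qualifies, so a maximum exists unless the dimensions
   are unbounded. *)
Definition u_invariant (F : fieldType) : option nat :=
  the_nat_or_infty (is_max_nat (dim_anisotropic F)).

Definition m_invariant (F : fieldType) : option nat :=
  the_nat_or_infty (is_min_nat (dim_anisotropic_universal F)).

Lemma u_invariantP (F : fieldType) (d : nat) :
  u_invariant F = Some d <-> is_max_nat (dim_anisotropic F) d.
Proof.
rewrite /u_invariant /the_nat_or_infty; case: pselect => [ex|nex]; last first.
  by split=> // H; case: nex; exists d.
case: (cid ex) => e [Pe maxe] /=; split=> [[<-] //|[Pd maxd]].
by congr Some; apply/eqP; rewrite eqn_leq maxe ?maxd.
Qed.

Lemma m_invariantP (F : fieldType) (d : nat) :
  m_invariant F = Some d <-> is_min_nat (dim_anisotropic_universal F) d.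
Proof.
rewrite /m_invariant /the_nat_or_infty; case: pselect => [ex|nex]; last first.
  by split=> // H; case: nex; exists d.
case: (cid ex) => e [Pe mine] /=; split=> [[<-] //|[Pd mind]].
by congr Some; apply/eqP; rewrite eqn_leq mine ?mind.
Qed.

(* Main.v *)
(** Call a quadratic form over [F = K((x))], possibly singular, anisotropic if
    it has no nontrivial zero.  In characteristic 2 the order of [q v] is, up to
    a factor 2, an ultrametric valuation on [V]: otherwise a plane would contain
    a zero of [q], by solving [t ^ 2 + t = c] for [c] of positive order.  The
    vectors with [ord (q v) >= 0], respectively [>= 1], modulo those of strictly
    larger order carry anisotropic residue forms [q0] and [q1] over [K].  Lifts
    of residue bases are independent because [ord (q v)] is even on the first
    span and odd on the second, and they generate [V] by completeness, so
    [dim q0 + dim q1 = dim q]; and if [q] is universal, so are [q0] and [q1].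
    By induction, starting from the algebraically closed field, every
    anisotropic form over [k((x_1))...((x_n))] has dimension at most [2 ^ n],
    and every universal anisotropic one exactly [2 ^ n].  Conversely an
    anisotropic form of dimension [2 ^ n] is universal, since adding [a z ^ 2]
    for a missed value [a] would exceed the bound.  Nonsingular examples arise
    from [u ^ 2 + u v + x_1^-1 v ^ 2] by iterating [q |-> q _|_ x q]. *)
From HB Require Import structures.
Require Import Defs.
From mathcomp Require Import all_boot all_order all_algebra.
From mathcomp Require Import zify ring boolp.

Set Implicit Arguments.
Unset Strict Implicit.
Unset Printing Implicit Defensive.

Import Order.TTheory GRing.Theory Num.Theory.
Local Open Scope ring_scope.

(** * Orders and monomials in [laurent K] *)

Section Order.
Variable K : fieldType.
Implicit Types (f g : laurent K) (a b : int) (c d : K).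

Lemma lcoefD f g i : (f + g) i = f i + g i. Proof. by []. Qed.
Lemma lcoefN f i : (- f) i = - f i. Proof. by []. Qed.

Lemma lcoef_sum I (r : seq I) (P : pred I) (f_ : I -> laurent K) i :
  (\sum_(j <- r | P j) f_ j) i = \sum_(j <- r | P j) f_ j i.
Proof. exact: (big_morph (fun f : laurent K => f i)). Qed.

Definition ord_ge a f := forall i, i < a -> f i = 0.
Definition has_ord a f := ord_ge a f /\ f a <> 0.

Lemma ord_ge0 a : ord_ge a 0. Proof. by []. Qed.

Lemma ord_geD a f g : ord_ge a f -> ord_ge a g -> ord_ge a (f + g).
Proof. by move=> fa ga i ia; rewrite lcoefD fa ?ga ?addr0. Qed.

Lemma ord_geN a f : ord_ge a f -> ord_ge a (- f).
Proof. by move=> fa i ia; rewrite lcoefN fa ?oppr0. Qed.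

Lemma ord_ge_sum a I (r : seq I) (P : pred I) (f_ : I -> laurent K) :
  (forall j, P j -> ord_ge a (f_ j)) -> ord_ge a (\sum_(j <- r | P j) f_ j).
Proof. by move=> fa i ia; rewrite lcoef_sum big1 // => j /fa; apply. Qed.

Lemma ord_geW a b f : b <= a -> ord_ge a f -> ord_ge b f.
Proof. by move=> ba fa i ib; apply: fa; lia. Qed.

Lemma ord_geS a f : ord_ge a f -> f a = 0 -> ord_ge (a + 1) f.
Proof. by move=> fa f0 i ia; have [->//|ia'] := eqVneq i a; apply: fa; lia. Qed.

Lemma ord_geM a b f g : ord_ge a f -> ord_ge b g -> ord_ge (a + b) (f * g).
Proof. by move=> fa gb; case: (lrep_mul (lrep_bound fa) (lrep_bound gb)). Qed.

Lemma lcoefM_lead a b f g :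
  ord_ge a f -> ord_ge b g -> (f * g) (a + b) = f a * g b.
Proof.
move=> fa gb; have [_ /(_ 0%N)] := lrep_mul (lrep_bound fa) (lrep_bound gb).
by rewrite !addr0 => ->; rewrite /conv big_ord1 subn0 !addr0.
Qed.

Lemma has_ordM a b f g : has_ord a f -> has_ord b g -> has_ord (a + b) (f * g).
Proof.
move=> [fa f0] [gb g0]; split; first exact: ord_geM.
by rewrite lcoefM_lead //; move/eqP: f0 => f0; move/eqP: g0 => g0;
   apply/eqP; rewrite mulf_neq0.
Qed.

Lemma has_ord_exists f : f != 0 -> exists a, has_ord a f.
Proof. by case/laurent_order=> a [fa /eqP f0]; exists a. Qed.

Lemma has_ord_neq0 a f : has_ord a f -> f != 0.
Proof. by case=> _ f0; apply/eqP => f_0; rewrite f_0 in f0. Qed.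

Lemma has_ord_inj a b f : has_ord a f -> has_ord b f -> a = b.
Proof.
move=> [fa f0] [fb g0]; case: (ltgtP a b) => // [/fb|/fa] //.
Qed.

Lemma has_ord1 : has_ord 0 (1 : laurent K).
Proof.
split; first by case: (lrep1 K).
by rewrite -[(1 : laurent K) 0]/(1 : K); apply/eqP/oner_neq0.
Qed.

Lemma has_ordV a f : has_ord a f -> has_ord (- a) f^-1.
Proof.
move=> fa; have f0 := has_ord_neq0 fa.
have [b fb] : exists b, has_ord b f^-1.
  by apply/has_ord_exists; rewrite invr_eq0.
have /has_ord_inj/(_ has_ord1) : has_ord (a + b) (1 : laurent K).
  by rewrite -(mulfV f0); apply: has_ordM.
by move=> ab; have -> : - a = b by lia.
Qed.

Lemma ord_ge_eq0 f : (forall N : nat, ord_ge N%:Z f) -> f = 0.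
Proof.
by move=> fN; apply: laurentP => i; apply: (fN `|i|.+1%N); lia.
Qed.

(** The monomial c x^a. *)
Definition lmon c a : laurent K :=
  Defs.lshift a (fun j => if j == 0%N then c else 0).

Lemma lcoef_lmon c a i : lmon c a i = if i == a then c else 0.
Proof.
by rewrite /lmon /=; case: ltP => ia; do ![case: ifP => // ?]; lia.
Qed.

Lemma lcoef_lmonM c a f i : (lmon c a * f) i = c * f (i - a).
Proof.
have [N fN] := lcoef_bounded f.
have [m0 mC] := lrep_mul (@lrep_shift K a (fun j => if j == 0%N then c else 0))
  (lrep_bound fN).
have [iN|iN] := ltP i (a + N).
  by rewrite [LHS](m0 _ iN) fN ?mulr0 //; lia.
have -> : i = a + N + (absz (i - (a + N))%R)%:Z by lia.
rewrite [LHS]mC /conv big_ord_recl /= subn0 big1 ?addr0 => [|j _];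
  last by rewrite mul0r.
by congr (c * lcoef f _); lia.
Qed.

Lemma lmonM c d a b : lmon c a * lmon d b = lmon (c * d) (a + b).
Proof.
apply: laurentP => i; rewrite lcoef_lmonM !lcoef_lmon.
by case: eqP => ?; case: eqP => ?; rewrite ?mulr0 //; lia.
Qed.

Lemma has_ord_lmon c a : c != 0 -> has_ord a (lmon c a).
Proof.
split; last by rewrite lcoef_lmon eqxx; apply/eqP.
by move=> i ia; rewrite lcoef_lmon; case: eqP => //; lia.
Qed.

Lemma lmon1_0 : lmon 1 0 = 1.
Proof.
by apply: laurentP => i; rewrite -[lmon 1 0]mulr1 lcoef_lmonM mul1r subr0.
Qed.

Definition lconst c := lmon c 0.

Lemma lcoef_const c i : lconst c i = if i == 0 then c else 0.
Proof. exact: lcoef_lmon. Qed.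

Lemma lcoef_constM c f i : (lconst c * f) i = c * f i.
Proof. by rewrite lcoef_lmonM subr0. Qed.

Fact lconst_zmod_morphism : zmod_morphism lconst.
Proof.
move=> c d; apply: laurentP => i; rewrite lcoefD lcoefN !lcoef_const.
by case: eqP; rewrite ?subr0.
Qed.

Fact lconst_monoid_morphism : monoid_morphism lconst.
Proof. by split=> [|c d]; rewrite /lconst ?lmon1_0 // lmonM addr0. Qed.

HB.instance Definition _ := GRing.isZmodMorphism.Build K (laurent K) lconst
  lconst_zmod_morphism.
HB.instance Definition _ := GRing.isMonoidMorphism.Build K (laurent K) lconst
  lconst_monoid_morphism.

Lemma ord_ge_const c : ord_ge 0 (lconst c).
Proof. by move=> i i0; rewrite lcoef_const; case: eqP => //; lia. Qed.

Lemma has_ord_const c : c != 0 -> has_ord 0 (lconst c).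
Proof. exact: has_ord_lmon. Qed.

Lemma laurent_pchar2 : 2%N \in [pchar K] -> 2%N \in [pchar (laurent K)].
Proof. exact: (rmorph_pchar lconst). Qed.

(** Supplies the power of x to factor out of a coordinate vector: after division by x^a the constant
    coefficients are not all zero. *)
Lemma ord_ge_family n (f_ : 'I_n -> laurent K) (j : 'I_n) : f_ j != 0 ->
  exists2 a, forall i, ord_ge a (f_ i) & exists i, f_ i a <> 0.
Proof.
move=> fj0.
have [N fN] : exists N, forall i, ord_ge N (f_ i).
  have /choice[N fN] i : exists N, ord_ge N (f_ i) by exact: lcoef_bounded.
  exists (- \sum_i (`|N i|%N)%:Z) => i; apply: ord_geW (fN i).
  rewrite (bigD1 i) //=; set s := \sum_(_ < _ | _) _.
  have : 0 <= s by apply: sumr_ge0.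
  lia.
have ex : exists m : nat, [exists i, f_ i (N + m%:Z) != 0].
  have [a fa] := has_ord_exists fj0; have [Na|aN] := leP N a; last first.
    by case: fa => _; rewrite fN.
  exists `|a - N|%N; apply/existsP; exists j; apply/eqP.
  have -> : N + (`|a - N|%N)%:Z = a by lia.
  by case: fa.
have [m /existsP[i /eqP fi] mmin] := ex_minnP ex.
exists (N + m%:Z); last by exists i.
move=> h l lm; have [/fN//|Nl] := ltP l N.
apply/eqP; apply: contraTT (lm) => /eqP fl.
have /mmin : [exists i, f_ i (N + (`|l - N|%N)%:Z) != 0].
  apply/existsP; exists h; apply/eqP.
  by have -> : N + (`|l - N|%N)%:Z = l by lia.
lia.
Qed.

End Order.

(** * The equation t^2 + t = c in characteristic 2 *)

Section ArtinSchreier.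
Variable K : fieldType.
Hypothesis K2 : 2%N \in [pchar K].
Implicit Types (C T : nat -> K).

(** Squaring is additive in characteristic 2: apply Frobenius to a polynomial truncation. *)
Lemma conv_square C k : conv C C k = if odd k then 0 else C k./2 ^+ 2.
Proof.
have P2 : 2%N \in [pchar {poly K}] by rewrite pchar_poly.
rewrite -(@coef_trunc_mul _ _ _ k.+1) // /trunc poly_def -expr2.
rewrite -(pFrobenius_autE P2) rmorph_sum coef_sum /=.
under eq_bigr do rewrite pFrobenius_autE exprZn -exprM coefZ coefXn.
case: ifPn => [ok|ek].
  by apply: big1 => i _; case: eqP => [ki|_]; rewrite ?mulr0 //; lia.
have hk : (k./2 < k.+1)%N by lia.
rewrite (bigD1 (Ordinal hk)) //= big1 ?addr0 => [|i].
  by rewrite (_ : _ == _) ?mulr1; last by lia.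
by rewrite -val_eqE /= => ik; case: eqP => [ki|_]; rewrite ?mulr0 //; lia.
Qed.

(** Comparing coefficients in t^2 + t = c gives T_k = C_k for odd k and T_k = C_k + T_{k/2}^2 for
    even k. This recursion is not structural, hence the fuel [n]. *)
Fixpoint artin_schreier_fuel C n k : K :=
  if n is m.+1 then
    C k + (if odd k then 0 else artin_schreier_fuel C m k./2 ^+ 2)
  else 0.

(** All fuels above k agree, since k/2 < k for k > 0; at k = 0 the recursion loops, and [C 0%N = 0]
    makes the value 0 for every fuel. *)
Lemma artin_schreier_coef C : C 0%N = 0 ->
  exists T, forall k, T k = C k + (if odd k then 0 else T k./2 ^+ 2).
Proof.
move=> C0; have T0 n : artin_schreier_fuel C n 0%N = 0.
  by elim: n => //= n ->; rewrite C0 expr0n addr0.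
have Tst m n k : (k < m)%N -> (k < n)%N ->
    artin_schreier_fuel C m k = artin_schreier_fuel C n k.
  elim: m n k => [|m IH] [|n] k //= km kn.
  congr (_ + _); case: ifP => // ek.
  have [->|k0] := eqVneq k 0%N; first by rewrite !T0.
  by rewrite (IH n) //; lia.
exists (fun k => artin_schreier_fuel C k.+1 k) => -[|k].
  by rewrite /= C0 !(expr0n, addr0).
rewrite -[LHS]/(C k.+1 + (if odd k.+1 then 0
                           else artin_schreier_fuel C k.+1 k.+1./2 ^+ 2)).
by rewrite (Tst k.+1 k.+1./2.+1) //; lia.
Qed.

Lemma artin_schreier (c : laurent K) : ord_ge 1 c -> exists t, t ^+ 2 + t = c.
Proof.
move=> c1; have cC := lrep_bound (ord_geW (isT : (0 : int) <= 1) c1).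
have [|T TC] := @artin_schreier_coef (fun j => c (0 + j%:Z)); first exact: c1.
have tT := @lrep_shift K 0 T; exists (Defs.lshift 0 T).
apply: lrep_eq (lrep_add (lrep_mul tT tT) tT) cC _ => k /=.
by rewrite conv_square [T k]TC addrCA addrr_pchar2 ?addr0.
Qed.

End ArtinSchreier.

(** * Identities for quadratic forms and their polar forms *)

Section PolarForm.
Variables (F : fieldType) (V : vectType F) (q : V -> F).
Hypothesis qQ : quadratic_form q.
Implicit Types (u v w : V) (a : F).

Lemma qformZ a v : q (a *: v) = a ^+ 2 * q v.
Proof. by case: qQ. Qed.

Lemma qform0 : q 0 = 0.
Proof. by rewrite -(scale0r 0) qformZ expr0n mul0r. Qed.

Lemma qformN v : q (- v) = q v.
Proof. by rewrite -scaleN1r qformZ sqrrN expr1n mul1r. Qed.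

Lemma qformD u v : q (u + v) = q u + q v + polar_form q u v.
Proof.
by rewrite /polar_form [RHS]addrC [q u + q v]addrC [RHS]addrA !subrK.
Qed.

Lemma polarC u v : polar_form q u v = polar_form q v u.
Proof. by rewrite /polar_form [u + v]addrC addrAC. Qed.

Lemma polarPl a u v w :
  polar_form q (a *: u + v) w = a * polar_form q u w + polar_form q v w.
Proof. by case: qQ => _ [+ _] => /(_ w a u v). Qed.

Lemma polarZl a u v : polar_form q (a *: u) v = a * polar_form q u v.
Proof.
have p0 w : polar_form q 0 w = 0.
  by rewrite /polar_form add0r qform0; ring.
by rewrite -[a *: u]addr0 polarPl p0 addr0.
Qed.

Lemma polarZr a u v : polar_form q u (a *: v) = a * polar_form q u v.
Proof. by rewrite polarC polarZl polarC. Qed.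

Lemma polar_id u : 2%N \in [pchar F] -> polar_form q u u = 0.
Proof.
move=> F2; rewrite /polar_form -mulr2n -scaler_nat qformZ.
by rewrite (pcharf0 F2) expr0n mul0r sub0r -opprD addrr_pchar2 ?oppr0.
Qed.

Lemma qform_scale a : quadratic_form (fun v => a * q v).
Proof.
split=> [b v|]; first by rewrite qformZ mulrCA.
have pE u v : polar_form (fun v => a * q v) u v = a * polar_form q u v.
  by rewrite /polar_form !mulrBr.
by split=> w b u v; rewrite !pE ?(polarC w) polarPl mulrDr mulrCA.
Qed.

Lemma anisotropic_scale a :
  a != 0 -> anisotropic q -> anisotropic (fun v => a * q v).
Proof. by move=> a0 qA v v0; rewrite mulf_neq0 ?qA. Qed.

Lemma universal_scale a :
  a != 0 -> universal q -> universal (fun v => a * q v).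
Proof.
move=> a0 qU b b0; have [|v qv] := qU (a^-1 * b).
  by rewrite mulf_neq0 ?invr_eq0.
by exists v; rewrite qv mulVKf.
Qed.

End PolarForm.

(** * Residue forms and Springer decomposition *)

Section ResidueForms.
Variables (K : fieldType) (V : vectType (laurent K)).
Hypothesis K2 : 2%N \in [pchar K].
Implicit Types (q : V -> laurent K) (u v w : V) (a b : int).

Section Valuation.
Variable q : V -> laurent K.
Hypotheses (qQ : quadratic_form q) (qA : anisotropic q).

(* Writing [B] for [polar_form q u v]: if [B] had smaller order, then
   [q u * q v / B ^+ 2] would have positive order, and Artin-Schreier would give
   a root of [q (s u + v)] as a polynomial in [s]. *)
Lemma ord_polar a b c u v : ord_ge a (q u) -> ord_ge b (q v) ->
  c + c <= a + b + 1 -> ord_ge c (polar_form q u v).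
Proof.
move=> ua vb cab; set B := polar_form q u v.
have [->|B0] := eqVneq B 0; first exact: ord_ge0.
have [r Br] := has_ord_exists B0; have [cr|rc] := leP c r.
  by apply: ord_geW cr _; case: Br.
have L2 := laurent_pchar2 K2.
have [u0|u0] := eqVneq u 0.
  by case/eqP: B0; rewrite /B u0 -(scale0r 0) (polarZl qQ) mul0r.
have Bi := has_ordV Br.
have [t tE] : exists t, t ^+ 2 + t = q u * q v / B ^+ 2.
  apply: artin_schreier => //; rewrite expr2 invfM.
  (* From r < c and c + c <= a + b + 1 follows a + b - 2 r >= 1. *)
  apply: (ord_geW (a := a + b + (- r + - r))); first by lia.
  by apply: ord_geM; [exact: ord_geM|case: (has_ordM Bi Bi)].
have qu0 : q u != 0 by exact: qA.
have : q ((t * B / q u) *: u + v) = 0.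
  rewrite (qformD q) (qformZ qQ) (polarZl qQ) -/B.
  have -> : (t * B / q u) ^+ 2 * q u + q v + t * B / q u * B =
     (t ^+ 2 + t) * (B ^+ 2 / q u) + q v by field.
  rewrite tE (_ : _ * _ = q v); last by field; rewrite qu0.
  exact: addrr_pchar2.
(* Anisotropy makes [v] a multiple of [u], and the alternating polar form then gives B = 0. *)
have [suv _|/qA/eqP//] := eqVneq ((t * B / q u) *: u + v) 0.
case/eqP: B0; rewrite /B -(addKr ((t * B / q u) *: u) v) suv addr0 -scaleNr.
by rewrite (polarZr qQ) (polar_id qQ) ?mulr0.
Qed.

Lemma ord_qformD a u v :
  ord_ge a (q u) -> ord_ge a (q v) -> ord_ge a (q (u + v)).
Proof.
move=> ua va; rewrite (qformD q); apply: ord_geD; first exact: ord_geD.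
by apply: ord_polar ua va _; lia.
Qed.

Lemma ord_qform_sum a I (r : seq I) (v_ : I -> V) :
  (forall i, ord_ge a (q (v_ i))) -> ord_ge a (q (\sum_(i <- r) v_ i)).
Proof.
move=> va; elim/big_ind: _ => //; first by rewrite (qform0 qQ); exact: ord_ge0.
by move=> u v; exact: ord_qformD.
Qed.

Lemma ord_qformZ a b (f : laurent K) v :
  ord_ge a f -> ord_ge b (q v) -> ord_ge (a + a + b) (q (f *: v)).
Proof.
move=> fa vb; rewrite (qformZ qQ) expr2; apply: ord_geM => //.
exact: ord_geM.
Qed.

(** The polar term has order at least 1/2, hence at least 1. So the residue of [q u] depends only on
    the residue class of [u]. *)
Lemma ord_qform_lead u v :
  ord_ge 0 (q u) -> ord_ge 1 (q v) -> q (u + v) 0 = q u 0.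
Proof.
move=> u0 v1; rewrite (qformD q) 2!lcoefD v1 // (ord_polar (c := 1) u0 v1) //.
by rewrite !addr0.
Qed.

(** Lifts a vector of the residue space: scalars of [K] act as constant series. *)
Definition rcomb m (e : m.-tuple V) (c : 'rV[K]_m) : V :=
  \sum_i lconst (c 0 i) *: e`_i.

Lemma rcombP m (e : m.-tuple V) x (c d : 'rV_m) :
  rcomb e (x *: c + d) = lconst x *: rcomb e c + rcomb e d.
Proof.
rewrite /rcomb scaler_sumr -big_split; apply: eq_bigr => i _.
by rewrite !mxE rmorphD rmorphM scalerDl scalerA.
Qed.

Lemma rcombZ m (e : m.-tuple V) x (c : 'rV_m) :
  rcomb e (x *: c) = lconst x *: rcomb e c.
Proof.
rewrite /rcomb scaler_sumr; apply: eq_bigr => i _.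
by rewrite mxE rmorphM scalerA.
Qed.

Lemma rcombN m (e : m.-tuple V) (c : 'rV_m) : rcomb e (- c) = - rcomb e c.
Proof.
by rewrite /rcomb -sumrN; apply: eq_bigr => i _; rewrite mxE rmorphN scaleNr.
Qed.

Lemma rcomb_delta m (e : m.-tuple V) i : rcomb e (delta_mx 0 i) = e`_i.
Proof.
rewrite /rcomb (bigD1 i) //= mxE !eqxx rmorph1 scale1r big1 ?addr0 // => j ji.
by rewrite mxE (negbTE ji) andbF rmorph0 scale0r.
Qed.

Lemma rcomb_cat m n (e : m.-tuple V) (f : n.-tuple V) c d :
  rcomb [tuple of e ++ f] (row_mx c d) = rcomb e c + rcomb f d.
Proof.
rewrite /rcomb big_split_ord; congr (_ + _); apply: eq_bigr => i _ /=.
  by rewrite row_mxEl nth_cat size_tuple ltn_ord.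
by rewrite row_mxEr nth_cat size_tuple ltnNge leq_addr /= addKn.
Qed.

(* The images of [e] in the residue space {ord q >= 0} / {ord q > 0} are
   linearly independent over [K]; the residue form is anisotropic. *)
Definition res_free m (e : m.-tuple V) :=
  forall c : 'rV[K]_m, c != 0 -> has_ord 0 (q (rcomb e c)).

Definition res_span m (e : m.-tuple V) :=
  forall v, ord_ge 0 (q v) -> exists c, ord_ge 1 (q (v - rcomb e c)).

Section ResFree.
Variables (m : nat) (e : m.-tuple V).
Hypothesis eF : res_free e.

Lemma ord_rcomb c : ord_ge 0 (q (rcomb e c)).
Proof.
have [->|/eqP/eqP/eF[] //] := eqVneq c 0.
rewrite /rcomb big1 ?(qform0 qQ) ?ord_ge0 // => i _.
by rewrite mxE rmorph0 scale0r.
Qed.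

Lemma ord_res_free i : ord_ge 0 (q e`_i).
Proof.
have [im|mi] := ltnP i m.
  by rewrite -(rcomb_delta e (Ordinal im)); exact: ord_rcomb.
by rewrite nth_default ?size_tuple // (qform0 qQ); exact: ord_ge0.
Qed.

(** With [a] the least order of the coefficients, the sum is x^a times a nonzero [rcomb] plus an
    error on which [q] has positive order. *)
Lemma ord_lin_comb (f : 'I_m -> laurent K) j : f j != 0 ->
  exists a, has_ord (a + a) (q (\sum_i f i *: e`_i)).
Proof.
move=> fj0; have [a fa [i fia]] := ord_ge_family fj0; exists a.
pose c := \row_i f i a; pose g i := lmon 1 (- a) * f i - lconst (f i a).
have g1 h : ord_ge 1 (g h).
  move=> l l1; rewrite lcoefD lcoefN lcoef_lmonM lcoef_const mul1r opprK.
  case: eqP => [->|l0]; first by rewrite add0r subrr.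
  by rewrite subr0; apply: fa; lia.
have -> : \sum_i f i *: e`_i = lmon 1 a *: (rcomb e c + \sum_i g i *: e`_i).
  rewrite /rcomb -big_split scaler_sumr; apply: eq_bigr => h _ /=.
  rewrite -scalerDl scalerA mxE addrC subrK mulrA lmonM.
  by rewrite mul1r subrr lmon1_0 mul1r.
have x_a : has_ord a (lmon 1 a : laurent K) by apply/has_ord_lmon/oner_neq0.
rewrite (qformZ qQ) -[a + a]addr0; apply: has_ordM.
  by rewrite expr2; exact: has_ordM.
have c0 : c != 0 by apply/eqP => /rowP/(_ i); rewrite !mxE.
have g2 : ord_ge 1 (q (\sum_i g i *: e`_i)).
  apply: ord_qform_sum => h; apply: (ord_geW (a := 1 + 1 + 0)) => //.
  by apply: ord_qformZ (g1 h) _; exact: ord_res_free.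
split; last by rewrite ord_qform_lead //; [case: (eF c0)|exact: ord_rcomb].
by apply: ord_qformD; [exact: ord_rcomb|exact: ord_geW g2].
Qed.

Lemma res_free_free : free e.
Proof.
apply/freeP => k k0 i; apply/eqP; apply: contraT => /ord_lin_comb[a].
by rewrite k0 (qform0 qQ) => /has_ord_neq0; rewrite eqxx.
Qed.

Lemma ord_span v : v \in <<e>>%VS -> v != 0 -> exists a, has_ord (a + a) (q v).
Proof.
move=> /coord_span vE v0.
have [j cj] : exists j, coord e j v != 0.
  apply: contrapT => no; case/eqP: v0; rewrite vE big1 // => i _.
  have [->|ci] := eqVneq (coord e i v) 0; first by rewrite scale0r.
  by case: no; exists i.
by rewrite vE; exact: (ord_lin_comb (f := fun i => coord e i v) cj).
Qed.

(** If [v] has coefficient s != 0, dividing by s leaves [v] minus a combination of [e], where [q]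
    has order exactly 0 by hypothesis; if s = 0 only [e] remains. *)
Lemma res_free_cons v : ord_ge 0 (q v) ->
  (forall c, ~ ord_ge 1 (q (v - rcomb e c))) -> res_free [tuple of v :: e].
Proof.
move=> v0 vn c c0; pose s := c 0 ord0; pose d := \row_i c 0 (lift ord0 i).
have -> : rcomb [tuple of v :: e] c = lconst s *: v + rcomb e d.
  rewrite /rcomb big_ord_recl; congr (_ + _).
  by apply: eq_bigr => i _; rewrite mxE.
have [s0|s0] := eqVneq s 0.
  rewrite s0 rmorph0 scale0r add0r; apply: eF.
  apply: contra_neq c0 => d0; apply/rowP => i; rewrite [RHS]mxE.
  case: (unliftP ord0 i) => [j ->|-> //].
  by move/rowP: d0 => /(_ j); rewrite !mxE.
have -> : rcomb e d = - (lconst s *: rcomb e (- (s^-1 *: d))).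
  rewrite rcombN scalerN opprK rcombZ scalerA.
  by rewrite -rmorphM mulfV // rmorph1 scale1r.
rewrite -scalerBr (qformZ qQ) -(addr0 0) -[0 as X in X + _](addr0 0).
apply: has_ordM; first by apply: has_ordM; exact: has_ord_const.
have w0 : ord_ge 0 (q (v - rcomb e (- (s^-1 *: d)))).
  by apply: ord_qformD; rewrite ?(qformN qQ) //; exact: ord_rcomb.
by split=> // /(ord_geS w0)/vn.
Qed.

End ResFree.

(** Take a residue-free family of maximal length: such families are free, which bounds their length,
    and a vector outside the residue span could be adjoined. *)
Lemma res_basis_exists : exists m (e : m.-tuple V), res_free e /\ res_span e.
Proof.
pose P := [pred m | `[< exists e : m.-tuple V, res_free e >]].
have P0 : exists m, P m.
  exists 0%N; apply/asboolP; exists [tuple] => c; case/eqP.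
  by apply/rowP => -[].
have Pub m : P m -> (m <= \dim {:V})%N.
  case/asboolP=> e /res_free_free; rewrite /free size_tuple => /eqP <-.
  exact/dimvS/subvf.
case: (ex_maxnP P0 Pub) => m /asboolP[e eF] mmax; exists m, e; split=> // v v0.
apply: contrapT => no.
have /mmax : P m.+1.
  apply/asboolP; exists [tuple of v :: e]; apply: res_free_cons => // c cv.
  by apply: no; exists c.
by rewrite ltnn.
Qed.

Definition res_form m (e : m.-tuple V) (c : 'rV[K]_m) : K := q (rcomb e c) 0.

Section ResForm.
Variables (m : nat) (e : m.-tuple V).
Hypothesis eF : res_free e.

Lemma res_form_quadratic : quadratic_form (res_form e).
Proof.
have rD c d : rcomb e (c + d) = rcomb e c + rcomb e d.
  by rewrite -[c]scale1r rcombP rmorph1 !scale1r.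
have pE c d :
    polar_form (res_form e) c d = polar_form q (rcomb e c) (rcomb e d) 0.
  by rewrite /polar_form /res_form !lcoefD !lcoefN rD.
split=> [x c|].
  by rewrite /res_form rcombZ (qformZ qQ) -rmorphXn lcoef_constM.
have lin x c d (w : 'rV_m) : polar_form (res_form e) (x *: c + d) w =
    x * polar_form (res_form e) c w + polar_form (res_form e) d w.
  by rewrite !pE rcombP (polarPl qQ) lcoefD lcoef_constM.
have sym c d : polar_form (res_form e) c d = polar_form (res_form e) d c.
  exact: polarC.
by split=> w x c d //; rewrite ![polar_form _ w _]sym lin.
Qed.

Lemma res_form_anisotropic : anisotropic (res_form e).
Proof. by move=> c /eF[_ /eqP]. Qed.

Lemma res_form_universal : res_span e -> universal q -> universal (res_form e).
Proof.
move=> eS qU x x0; have [|v qv] := qU (lconst x).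
  by rewrite fmorph_eq0.
have [|c vc] := eS v; first by rewrite qv; exact: ord_ge_const.
exists c; rewrite /res_form.
transitivity (q v 0); last by rewrite qv lcoef_const.
rewrite -[v in RHS](subrK (rcomb e c)) addrC ord_qform_lead //.
exact: ord_rcomb.
Qed.

End ResForm.

(* Successive approximation: [T] produces the next remainder, and the digits
   [c (iter j T v)] are the coefficients of the coordinates of [v]. *)
Lemma span_of_approx n (g : n.-tuple V) :
  (forall i : 'I_n, ord_ge 0 (q g`_i)) ->
  (forall v, ord_ge 0 (q v) ->
     exists c, ord_ge 2 (q (v - rcomb g c))) ->
  <<g>>%VS = fullv.
Proof.
move=> g0 gA.
have step v : exists cT : 'rV[K]_n * V, ord_ge 0 (q v) ->
    v = rcomb g cT.1 + lmon 1 1 *: cT.2 /\ ord_ge 0 (q cT.2).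
  (* The pair (0, 0) is a dummy value when [q v] has negative order, as [choice] requires a total
     relation. *)
  have [/gA[c cv]|nv] := pselect (ord_ge 0 (q v)); last by exists (0, 0).
  exists (c, lmon 1 (-1) *: (v - rcomb g c)) => _ /=; split.
    by rewrite scalerA lmonM mulr1 subrr lmon1_0 scale1r addrC subrK.
  (* Dividing a vector by x lowers the order of [q] by 2, whence the bound 2 in the hypothesis. *)
  apply: (ord_geW (a := -1 + -1 + 2)) => //; apply: ord_qformZ => //.
  by case: (has_ord_lmon (-1) (oner_neq0 K)).
have {step}[cT cTP] := choice step.
pose T v := (cT v).2.
pose al v i : laurent K := Defs.lshift 0 (fun j => (cT (iter j T v)).1 0 i).
pose R v := v - \sum_i al v i *: g`_i.
have alE v i : al v i = lconst ((cT v).1 0 i) + lmon 1 1 * al (T v) i.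
  apply: laurentP => l; rewrite lcoefD lcoef_const lcoef_lmonM mul1r /=.
  have [->|l0] := eqVneq l 0; first by rewrite /= addr0.
  rewrite add0r !subr0; case: ltP => l1; first by rewrite ifT //; lia.
  rewrite ifF; last by lia.
  by rewrite -iterSr; congr ((cT (iter _ _ _)).1 0 i); lia.
have TP v : ord_ge 0 (q v) -> ord_ge 0 (q (T v)) by case/cTP.
(* Each application of [T] extracts a factor x from the error [R v], so [q (R v)] has order above
   every bound and [R v] vanishes. *)
have RE v : ord_ge 0 (q v) -> R v = lmon 1 1 *: R (T v).
  move=> v0; rewrite /R {1}(proj1 (cTP v v0)) scalerBr scaler_sumr -/(T v).
  under eq_bigr do rewrite alE scalerDl -scalerA.
  by rewrite big_split /= opprD addrACA subrr add0r.
have R0 v : ord_ge 0 (q v) -> ord_ge 0 (q (R v)).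
  move=> v0; apply: ord_qformD => //; rewrite (qformN qQ).
  apply: ord_qform_sum => i; apply: (@ord_qformZ 0 0) => //.
  by case: (@lrep_shift K 0 (fun j => (cT (iter j T v)).1 0 i)).
have RN (N : nat) v : ord_ge 0 (q v) -> ord_ge N%:Z (q (R v)).
  elim: N v => [|N IH] v v0; first exact: R0.
  rewrite (RE _ v0); apply: (ord_geW (a := 1 + 1 + N%:Z)); first by lia.
  apply: ord_qformZ; last exact/IH/TP.
  by case: (has_ord_lmon 1 (oner_neq0 K)).
have spanP v : ord_ge 0 (q v) -> v \in <<g>>%VS.
  move=> v0; have : R v = 0.
    apply/eqP; apply: contraT => /qA; rewrite (_ : q _ = 0) ?eqxx //.
    by apply: ord_ge_eq0 => N; exact: RN.
  move/eqP; rewrite subr_eq0 => /eqP ->; apply: memv_suml => i _.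
  by apply/memvZ/memv_span/mem_nth; rewrite size_tuple.
apply/eqP; rewrite eqEsubv subvf; apply/subvP => v _.
(* A large power of x moves any vector into {ord q >= 0}. *)
have [a va] := lcoef_bounded (q v).
have x0 : lmon (1 : K) (`|a|%N)%:Z != 0.
  exact: has_ord_neq0 (has_ord_lmon _ (oner_neq0 K)).
rewrite -[v](scalerK x0) memvZ // spanP //.
apply: (ord_geW (a := (`|a|%N)%:Z + (`|a|%N)%:Z + a)); first by lia.
by apply: ord_qformZ => //; case: (has_ord_lmon (`|a|%N)%:Z (oner_neq0 K)).
Qed.

End Valuation.

Theorem springer_decomposition q : quadratic_form q -> anisotropic q ->
  exists m n (q0 : 'rV[K]_m -> K) (q1 : 'rV[K]_n -> K),
  [/\ quadratic_form q0 /\ anisotropic q0, quadratic_form q1 /\ anisotropic q1,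
      \dim {:V} = (m + n)%N & universal q -> universal q0 /\ universal q1].
Proof.
(* The second residue form of [q] is the first one of x^-1 q, for which order 0 corresponds to order
   1 of [q]. *)
move=> qQ qA; pose p v := lmon 1 (-1) * q v.
have x0 : lmon (1 : K) (-1) != 0.
  exact: has_ord_neq0 (has_ord_lmon _ (oner_neq0 K)).
have pQ : quadratic_form p by exact: qform_scale.
have pA : anisotropic p by exact: anisotropic_scale.
have pE v i : p v i = q v (i + 1) by rewrite /p lcoef_lmonM mul1r opprK.
have ord_p a v : ord_ge a (p v) <-> ord_ge (a + 1) (q v).
  split=> va i ia; last by rewrite pE va //; lia.
  by rewrite -[i](subrK 1) -pE va //; lia.
have [m [e [eF eS]]] := res_basis_exists qQ qA.
have [n [f [fF fS]]] := res_basis_exists pQ pA.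
exists m, n, (res_form q e), (res_form p f).
have dimV : \dim {:V} = (m + n)%N.
  have ef_free : free [tuple of e ++ f].
    rewrite cat_free (res_free_free qQ qA eF) (res_free_free pQ pA fF) /=.
    (* On a nonzero common vector [q] and [p] would both have even order, but these orders differ by
       1. *)
    apply/directv_addP/eqP; rewrite -subv0; apply/subvP => v.
    rewrite memv_cap memv0 => /andP[ve vf]; apply: contraT => v0.
    have [a qa] := ord_span qQ qA eF ve v0.
    have [b [pb pb0]] := ord_span pQ pA fF vf v0.
    have : has_ord (b + b + 1) (q v) by split; [exact/ord_p|rewrite -pE].
    by move/(has_ord_inj qa); lia.
  rewrite -(span_of_approx qQ qA (g := [tuple of e ++ f])).
  - by move/eqP: ef_free => ->; rewrite size_tuple.
  - move=> i /=; rewrite nth_cat; case: ifP => _.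
      exact: (ord_res_free qQ eF).
    by apply: (ord_geW (a := 0 + 1)) => //; apply/ord_p/(ord_res_free pQ fF).
  (* Correcting by [e] reaches order 1, then correcting by [f] reaches the order 2 required for
     approximation. *)
  - move=> v v0; have [c vc] := eS v v0.
    have [d vd] := fS (v - rcomb e c) (proj2 (ord_p 0 _) vc).
    by exists (row_mx c d); rewrite rcomb_cat opprD addrA; apply/(ord_p 1).
split=> //.
- by split; [exact: res_form_quadratic|exact: res_form_anisotropic].
- by split; [exact: res_form_quadratic|exact: res_form_anisotropic].
- by move=> qU; split; apply: res_form_universal => //; exact: universal_scale.
Qed.

End ResidueForms.

(** * Quadratic forms given by matrices *)

Section MatrixForms.
Variables (F : fieldType).

(** [A] is not taken symmetric: in characteristic 2 a symmetric matrix yields only a diagonal form,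
    with zero polar form. *)
Definition mxform n (A : 'M[F]_n) (v : 'rV_n) : F := (v *m A *m v^T) 0 0.

Lemma mxformE n (A : 'M_n) v :
  mxform A v = \sum_j (\sum_i v 0 i * A i j) * v 0 j.
Proof. by rewrite /mxform mxE; apply: eq_bigr => j _; rewrite !mxE. Qed.

Lemma mxform_scale n (A : 'M_n) a v : mxform (a *: A) v = a * mxform A v.
Proof. by rewrite /mxform -scalemxAr -scalemxAl mxE. Qed.

Lemma mxform_block m n (A : 'M_m) (B : 'M_n) (C : 'M_(m, n)) u v :
  mxform (block_mx A C 0 B) (row_mx u v) =
  mxform A u + (u *m C *m v^T) 0 0 + mxform B v.
Proof.
by rewrite /mxform mul_row_block tr_row_mx mul_row_col mulmx0 addr0 mulmxDl
  addrA !mxE.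
Qed.

Lemma polar_mxform n (A : 'M_n) v w :
  polar_form (mxform A) v w = (v *m (A + A^T) *m w^T) 0 0.
Proof.
have trE : (v *m A^T *m w^T) 0 0 = (w *m A *m v^T) 0 0.
  rewrite [LHS](_ : _ = (v *m A^T *m w^T)^T 0 0); last by rewrite [RHS]mxE.
  by rewrite !trmx_mul !trmxK mulmxA.
have addE (M N : 'M[F]_1) : (M + N) 0 0 = M 0 0 + N 0 0 by rewrite mxE.
rewrite /polar_form /mxform [(v + w)^T]linearD /= !(mulmxDr, mulmxDl) !addE trE.
ring.
Qed.

Lemma mxform_quadratic n (A : 'M_n) : quadratic_form (mxform A).
Proof.
split=> [a v|].
  by rewrite /mxform linearZ /= -scalemxAr -!scalemxAl scalerA mxE expr2.
split=> w a u v; rewrite !polar_mxform.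
  by rewrite !mulmxDl -!scalemxAl !mxE.
by rewrite linearP /= mulmxDr -scalemxAr !mxE.
Qed.

Lemma mxform_nonsingular n (A : 'M_n) :
  A + A^T \in unitmx -> nonsingular (mxform A).
Proof.
move=> AU v vA; have vA0 : v *m (A + A^T) = 0.
  apply/rowP => j; rewrite [RHS]mxE; have := vA (delta_mx 0 j).
  by rewrite polar_mxform trmx_delta -colE !mxE.
by rewrite -[v](mulmxK AU) vA0 mul0mx.
Qed.

End MatrixForms.

(** * Anisotropic nonsingular forms over [laurent K] *)

Section LaurentMatrixForms.
Variable K : fieldType.

(** With [a] the least order of the coordinates, the coefficient of x^(2a) is [mxform A] at their
    nonzero vector of coefficients of x^a. *)
Lemma ord_mxform n (A : 'M[K]_n) v : anisotropic (mxform A) -> v != 0 ->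
  exists a, has_ord (a + a) (mxform (map_mx (@lconst K) A) v).
Proof.
move=> AA v0; have [j vj] : exists j, v 0 j != 0.
  apply: contrapT => no; case/eqP: v0; apply/rowP => j; rewrite [RHS]mxE.
  by apply: contrapT => /eqP vj; apply: no; exists j.
have [a va [i via]] := ord_ge_family (f_ := fun i => v 0 i) vj; exists a.
pose c := \row_i v 0 i a.
have wa i' : ord_ge a (\sum_h v 0 h * map_mx (@lconst K) A h i').
  apply: ord_ge_sum => h _; rewrite -[a]addr0; apply: ord_geM => //.
  by rewrite mxE; exact: ord_ge_const.
rewrite mxformE; split.
  by apply: ord_ge_sum => h _; exact: ord_geM.
suff -> : (\sum_h (\sum_l v 0 l * map_mx (@lconst K) A l h) * v 0 h) (a + a)
    = mxform A c.
  apply/eqP/AA; apply: contra_notN via => /eqP/rowP/(_ i).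
  by rewrite !mxE.
rewrite mxformE lcoef_sum; apply: eq_bigr => h _.
rewrite (lcoefM_lead (wa h) (va h)) lcoef_sum mxE; congr (_ * _).
apply: eq_bigr => l _; rewrite -[a in LHS]addr0.
by rewrite (lcoefM_lead (va l)) ?mxE ?lcoef_const //; exact: ord_ge_const.
Qed.

(** In q _|_ x q nonzero values have even order on the first summand and odd order on the second, so
    they cannot cancel. The polar determinant is x^n D^2, with D that of [A]. *)
Lemma mxform_step n (A : 'M[K]_n) :
  anisotropic (mxform A) -> A + A^T \in unitmx ->
  exists B : 'M[laurent K]_(n + n),
    anisotropic (mxform B) /\ B + B^T \in unitmx.
Proof.
move=> AA AU; pose B := map_mx (@lconst K) A.
have x1 : has_ord 1 (lmon (1 : K) 1) by exact/has_ord_lmon/oner_neq0.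
exists (block_mx B 0 0 (lmon 1 1 *: B)); split.
  move=> v; rewrite -[v]hsubmxK.
  move: (lsubmx v) (rsubmx v) => {}v w vw0.
  rewrite mxform_block mulmx0 mul0mx [X in _ + X + _]mxE addr0 mxform_scale.
  apply: contra_neq vw0 => /eqP; rewrite addr_eq0 => /eqP vw.
  have q0 : mxform B 0 = 0 by exact/qform0/mxform_quadratic.
  have [w0|/(ord_mxform AA)[b wb]] := eqVneq w 0.
    have [->|/(ord_mxform AA)[a /has_ord_neq0]] := eqVneq v 0.
      by rewrite w0 row_mx0.
    by rewrite -/B vw w0 q0 mulr0 oppr0 eqxx.
  have xw : has_ord (1 + (b + b)) (mxform B v).
    rewrite vw; case: (has_ordM x1 wb) => xw1 xw0.
    by split; [exact: ord_geN|move=> /eqP; rewrite oppr_eq0 => /eqP].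
  have [v0|/(ord_mxform AA)[a va]] := eqVneq v 0.
    by move/has_ord_neq0: xw; rewrite v0 q0 eqxx.
  by have := has_ord_inj va xw; lia.
rewrite tr_block_mx add_block_mx !trmx0 addr0 unitmxE det_ublock.
rewrite linearZ /= -scalerDr detZ map_trmx -map_mxD det_map_mx.
have AD : lconst (\det (A + A^T)) != 0.
  by rewrite fmorph_eq0 -unitfE -unitmxE.
by rewrite unitfE !mulf_neq0 // expf_neq0 // (has_ord_neq0 x1).
Qed.

(** A zero of u^2 + u v + x^-1 v^2 with v != 0 gives y^2 + y = x^-1 for y = u / v. The left side has
    order 2 ord y if ord y < 0, and order at least 0 otherwise, never -1. *)
Lemma mxform_base : 2%N \in [pchar K] ->
  exists B : 'M[laurent K]_(1 + 1),
    anisotropic (mxform B) /\ B + B^T \in unitmx.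
Proof.
move=> K2; have L2 := laurent_pchar2 K2.
pose x' := lmon (1 : K) (-1).
exists (block_mx 1%:M 1%:M 0 x'%:M); split; last first.
  rewrite tr_block_mx add_block_mx !tr_scalar_mx trmx0 add0r addr0.
  have add11 (a : laurent K) : a%:M + a%:M = 0 :> 'M_1.
    by rewrite -raddfD /= addrr_pchar2 ?raddf0.
  rewrite !add11; set J := block_mx _ _ _ _.
  apply: (proj1 (mulmx1_unit (B := J) _)).
  rewrite mulmx_block !(mul0mx, mulmx0, mulmx1, add0r, addr0).
  by rewrite -scalar_mx_block.
move=> v; rewrite -[v]hsubmxK.
rewrite [lsubmx v]mx11_scalar [rsubmx v]mx11_scalar.
move: (lsubmx v 0 0) (rsubmx v 0 0) => {v} a b ab0.
have -> : mxform (block_mx 1%:M 1%:M 0 x'%:M) (row_mx a%:M b%:M) =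
    a ^+ 2 + a * b + x' * b ^+ 2.
  rewrite mxform_block /mxform !tr_scalar_mx -!scalar_mxM !mxE eqxx !mulr1n.
  by ring.
apply: contra_neq ab0 => ab.
have [b0|b0] := eqVneq b 0.
  move/eqP: ab; rewrite b0 mulr0 expr0n mulr0 !addr0 expf_eq0 /= => /eqP ->.
  by rewrite raddf0 row_mx0.
pose y := a / b; have yE : y ^+ 2 + y = x'.
  have : y ^+ 2 + y + x' = 0.
    rewrite -[RHS](mul0r (b ^+ 2)^-1) -ab /y; field.
    exact: b0.
  by move/eqP; rewrite addr_eq0 oppr_pchar2 // => /eqP.
have x'1 : has_ord (-1) x' by exact/has_ord_lmon/oner_neq0.
have y0 : y != 0.
  by apply: contra_eq_neq yE => ->; rewrite expr0n addr0 eq_sym;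
    exact: has_ord_neq0 x'1.
have [r yr] := has_ord_exists y0.
have y2r : has_ord (r + r) (y ^+ 2) by rewrite expr2; exact: has_ordM.
have [r0|r0] := leP 0 r.
  case: x'1 => _ []; rewrite -yE lcoefD (proj1 yr); last by lia.
  by rewrite addr0 (proj1 y2r) //; lia.
have : has_ord (r + r) x'.
  rewrite -yE; split.
    apply: ord_geD; first by case: y2r.
    by case: yr => yr _; apply: ord_geW yr; lia.
  rewrite lcoefD (proj1 yr); last by lia.
  by rewrite addr0; case: y2r.
by move/(has_ord_inj x'1); lia.
Qed.

End LaurentMatrixForms.

(** * Induction on the number of variables *)

Section IterLaurent.
Variable k : closedFieldType.
Hypothesis k2 : 2%N \in [pchar k].

Lemma iter_laurent_pchar2 n : 2%N \in [pchar (iter_laurent k n)].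
Proof. by elim: n => //= n; exact: laurent_pchar2. Qed.

(** For u != 0, q (s u + v) is quadratic in s with leading coefficient q u != 0; at a root
    anisotropy forces [v] onto the line of [u]. *)
Lemma closed_anisotropic_dim (V : vectType k) (q : V -> k) :
  quadratic_form q -> anisotropic q -> (\dim {:V} <= 1)%N.
Proof.
move=> qQ qA; have [V0|V0] := eqVneq (fullv : {vspace V}) 0%VS.
  by rewrite V0 dimv0.
set u := vpick {:V}; have u0 : u != 0 by rewrite vpick0.
have <- : \dim <[u]> = 1%N by rewrite dim_vline u0.
apply/dimvS/subvP => v _.
have qu0 := qA u u0.
(* The list holds the coefficients of s^0 and s^1 in the equation solved for s^2. *)
have [s sE] := @solve_monicpoly k 2
  (nth 0 [:: - (q v / q u); - (polar_form q u v / q u)]) isT.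
have : q (s *: u + v) = 0.
  rewrite qformD (qformZ qQ) (polarZl qQ) sE !big_ord_recl big_ord0 /=.
  by field.
have [suv _|/qA/eqP//] := eqVneq (s *: u + v) 0.
rewrite -(addKr (s *: u) v) suv addr0 -scaleNr.
by apply/memvZ/memv_line.
Qed.

(** The induction ranges over singular forms too, since residue forms of a nonsingular form can be
    singular. *)
Lemma anisotropic_dim_le n (V : vectType (iter_laurent k n)) (q : V -> _) :
  quadratic_form q -> anisotropic q -> (\dim {:V} <= 2 ^ n)%N.
Proof.
elim: n V q => [|n IH] V q qQ qA; first exact: closed_anisotropic_dim qQ qA.
have [m [l [q0 [q1 [[q0Q q0A] [q1Q q1A] -> _]]]]] :=
  springer_decomposition (iter_laurent_pchar2 n) qQ qA.
have := IH _ _ q0Q q0A; have := IH _ _ q1Q q1A.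
by rewrite !dimvf !dim_matrix !mul1r expnS mul2n -addnn; lia.
Qed.

Lemma universal_dim_ge n (V : vectType (iter_laurent k n)) (q : V -> _) :
  quadratic_form q -> anisotropic q -> universal q -> (2 ^ n <= \dim {:V})%N.
Proof.
elim: n V q => [|n IH] V q qQ qA qU.
  have [v qv] := qU 1 (oner_neq0 _); rewrite lt0n dimv_eq0.
  apply: contra_eqN qv => /eqP V0.
  have : v \in fullv by exact: memvf.
  rewrite V0 memv0 => /eqP ->.
  by rewrite (qform0 qQ) eq_sym oner_eq0.
have [m [l [q0 [q1 [[q0Q q0A] [q1Q q1A] -> /(_ qU)[q0U q1U]]]]]] :=
  springer_decomposition (iter_laurent_pchar2 n) qQ qA.
have := IH _ _ q0Q q0A q0U; have := IH _ _ q1Q q1A q1U.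
by rewrite !dimvf !dim_matrix !mul1r expnS mul2n -addnn; lia.
Qed.

(** If [a] is missed, q + a s^2 is anisotropic, as a zero with s != 0 gives q (v / s) = a; its
    dimension 2^n + 1 exceeds the bound. *)
Lemma anisotropic_universal n (V : vectType (iter_laurent k n)) (q : V -> _) :
  quadratic_form q -> anisotropic q -> \dim {:V} = (2 ^ n)%N -> universal q.
Proof.
move=> qQ qA dV a a0; apply: contrapT => no.
pose F := iter_laurent k n; have F2 := iter_laurent_pchar2 n.
pose q' (p : (V * F^o)%type) : F := q p.1 + a * p.2 ^+ 2.
(* Squaring is additive in characteristic 2, so the new term has zero polar form. *)
have pE p r : polar_form q' p r = polar_form q p.1 r.1.
  rewrite /polar_form /q' /=.
  have -> : (p.2 + r.2) ^+ 2 = p.2 ^+ 2 + r.2 ^+ 2 :> F.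
    by rewrite sqrrD -mulr_natl (pcharf0 F2) mul0r addr0.
  by ring.
have q'Q : quadratic_form q'.
  split=> [b [v s]|].
    by rewrite /q' /= (qformZ qQ) exprMn; ring.
  split=> w b u v; rewrite !pE /=; first exact: polarPl.
  by rewrite !(polarC q w.1); exact: polarPl.
have q'A : anisotropic q'.
  move=> [v s] vs0; rewrite /q' /=; apply: contra_not_neq no => qvs.
  have [s0|s0] := eqVneq (s : F) 0.
    case/eqP: vs0; congr (_, _) => //; apply/eqP; apply: contraT => /qA.
    by move: qvs; rewrite s0 expr0n mulr0 addr0 => ->; rewrite eqxx.
  exists (s^-1 *: v); rewrite (qformZ qQ).
  move/eqP: qvs; rewrite addr_eq0 oppr_pchar2 // => /eqP ->.
  by rewrite exprVn mulrC mulfK ?expf_neq0.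
have := anisotropic_dim_le q'Q q'A.
have -> : (\dim {: (V * F^o)%type} = \dim {:V} + 1)%N by rewrite !dimvf.
by rewrite dV addn1 ltnn.
Qed.

(** The size is a variable with an equation, so that doubling to [d + d] requires no cast. *)
Lemma anisotropic_mxform_exists n : exists d (A : 'M[iter_laurent k n.+1]_d),
  [/\ d = (2 ^ n.+1)%N, anisotropic (mxform A) & A + A^T \in unitmx].
Proof.
elim: n => [|n [d [A [dE AA AU]]]].
  by have [A []] := mxform_base k2; exists 2%N, A.
have [B []] := mxform_step AA AU; exists (d + d)%N, B.
by split=> //; rewrite dE [RHS]expnS mul2n addnn.
Qed.

End IterLaurent.

Theorem corollary5p2 (k : closedFieldType) (hk : 2%N \in [pchar k])
    (n : nat) (hn : (1 <= n)%N) :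
  u_invariant (iter_laurent k n) = Some (2 ^ n)%N /\
  m_invariant (iter_laurent k n) = Some (2 ^ n)%N.
Proof.
(* In dimension 2^0 = 1 the alternating polar form is zero, so the nonsingular examples start with
   one variable. *)
case: n hn => // n _.
have [d [A [dE AA AU]]] := anisotropic_mxform_exists hk n.
have dV : \dim {:'rV[iter_laurent k n.+1]_d} = (2 ^ n.+1)%N.
  by rewrite dimvf dim_matrix mul1r.
have AQ := mxform_quadratic A; have AN := mxform_nonsingular AU.
split; [apply/u_invariantP|apply/m_invariantP]; split.
- by exists _, (mxform A).
- by move=> e [V [q [<- qQ _ qA]]]; exact: (anisotropic_dim_le hk qQ qA).
- by exists _, (mxform A); split=> //; exact: anisotropic_universal.
- move=> e [V [q [<- qQ _ qA qU]]].
  exact: (universal_dim_ge hk qQ qA qU).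
Qed.
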